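(* Let $k\ge 2$ be an integer and let $\phi_k:[0,1]\to[0,1]$ be the infinitely piecewise linear map given by $\phi_k(x)=\frac{2}{2^k}\left(x-\frac12\right)$ for $x\in[\frac12,1]$, and $\phi_k(x)=2^i\left(x-\frac{1}{2^i}\right)$ for $x\in[2^{-i},2^{1-i})$, $i=2,3,\ldots$ (with $\phi_k(0)=0$). Then the invariant density of $\phi_k$ is $$\rho^{(k)}(x)=\begin{cases}\frac{2^k+2}{3}, & x\in\left[0,\frac{1}{2^k}\right),\\[2pt] \frac23, & x\in\left[\frac{1}{2^k},\frac12\right),\\[2pt] \frac23, & x\in\left[\frac12,1\right].\end{cases}$$
   Context: An invariant density of a Borel measurable map $\phi:[0,1]\to[0,1]$ is a probability density $\rho$ on $[0,1]$ with respect to Lebesgue measure (i.e. $\rho\ge 0$ is measurable and $\int_0^1\rho(x)\,dx=1$) such that the measure $\mu(A)=\int_A\rho(x)\,dx$ is $\phi$-invariant: $\mu(\phi^{-1}(A))=\mu(A)$ for every Borel set $A\subseteq[0,1]$. Equivalently, $\rho$ is a fixed point of the Perron–Frobenius operator of $\phi$. Densities that are equal Lebesgue-almost everywhere are identified. *)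

(* Defs.v *)
From HB Require Import structures.
From mathcomp Require Import all_boot all_order all_algebra.
From mathcomp Require Import all_classical all_reals all_analysis.
From mathcomp Require Import lra.

Set Implicit Arguments.
Unset Strict Implicit.
Unset Printing Implicit Defensive.

Import Order.TTheory GRing.Theory Num.Theory.
Import numFieldNormedType.Exports.

Local Open Scope classical_set_scope.
Local Open Scope ring_scope.

(* Self-maps of [0, 1] and densities on [0, 1] are represented by total
   functions R -> R; their values outside [0, 1] are irrelevant. *)

Definition I01 (R : realType) : set R := `[0, 1].

Definition probability_density (R : realType) (rho : R -> R) : Prop :=
  [/\ measurable_fun (@I01 R) rho,
      (forall x : R, x \in `[0, 1] -> 0 <= rho x) &
      (\int[lebesgue_measure]_(x in @I01 R) (rho x)%:E = 1)%E].

Definition invariant_density (R : realType) (f rho : R -> R) : Prop :=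
  probability_density rho /\
  forall A : set R, measurable A -> A `<=` @I01 R ->
    (\int[lebesgue_measure]_(x in @I01 R `&` f @^-1` A) (rho x)%:E
     = \int[lebesgue_measure]_(x in A) (rho x)%:E)%E.

(* For x in ]0, 1/2[ this is a singleton, so that [get] below returns the index
   of the branch containing x; it is empty for x <= 0. *)
Definition branch (R : realType) (x : R) : set nat :=
  [set i : nat | (2 <= i)%N /\ x \in `[2 ^- i, 2 ^- i.-1[].

Definition phi (R : realType) (k : nat) (x : R) : R :=
  if x \in `[2^-1, 1] then 2 / 2 ^+ k * (x - 2^-1)
  else if branch x == set0 then 0
  else let i := get (branch x) in 2 ^+ i * (x - 2 ^- i).

Definition rhok (R : realType) (k : nat) (x : R) : R :=
  if x \in `[0, 2 ^- k[ then (2 ^+ k + 2) / 3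
  else if x \in `[2 ^- k, 2^-1[ then 2 / 3
  else if x \in `[2^-1, 1] then 2 / 3
  else 0.

Section phi_spec.
Variables (R : realType) (k : nat).
Implicit Types (x : R) (i j : nat).

Lemma phi_upper x : x \in `[2^-1, 1] -> phi k x = 2 / 2 ^+ k * (x - 2^-1).
Proof. by rewrite /phi => ->. Qed.

Lemma branch_lt i x : (2 <= i)%N -> x \in `[2 ^- i, 2 ^- i.-1[ ->
  0 < x < 2^-1.
Proof.
move=> i2; rewrite in_itv/= => /andP[ix xi]; apply/andP; split.
  by rewrite (lt_le_trans _ ix)// invr_gt0 exprn_gt0.
rewrite (lt_le_trans xi)// lef_pV2 ?posrE ?exprn_gt0//.
by rewrite -{1}(expr1 2) ler_eXn2l ?ltr1n//; case: i i2 {ix xi} => [|[]].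
Qed.

Lemma branch_uniq i j x : branch x i -> branch x j -> i = j.
Proof.
wlog ij : i j / (i < j)%N.
  by move=> H bi bj; case: (ltngtP i j) => // ij; [exact: H|apply/esym/H].
move=> [_ /[!in_itv]/= /andP[ix _]] [_ /[!in_itv]/= /andP[_ xj]].
suff : 2 ^- j.-1 <= 2 ^- i :> R by rewrite leNgt (le_lt_trans ix xj).
rewrite lef_pV2 ?posrE ?exprn_gt0// ler_eXn2l ?ltr1n//.
by case: j ij {xj}.
Qed.

Lemma phi_branch i x : (2 <= i)%N -> x \in `[2 ^- i, 2 ^- i.-1[ ->
  phi k x = 2 ^+ i * (x - 2 ^- i).
Proof.
move=> i2 xi; have bi : branch x i by split.
have /andP[_ xlt] := branch_lt i2 xi.
rewrite /phi in_itv/= leNgt xlt/=.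
have -> : (branch x == set0) = false.
  by apply/negP => /eqP b0; move: bi; rewrite b0.
have bg : branch x (get (branch x)) by apply: (getI bi).
by rewrite (branch_uniq bg bi).
Qed.

Lemma phi_0 : phi k 0 = 0 :> R.
Proof.
rewrite /phi in_itv/= leNgt invr_gt0 ltr0n/=.
case: ifPn => // /set0P[i [i2 /(branch_lt i2)]].
by rewrite ltxx.
Qed.

Lemma branchP x : 0 < x < 2^-1 ->
  exists i, (2 <= i)%N /\ x \in `[2 ^- i, 2 ^- i.-1[.
Proof.
move=> /andP[x0 x1].
have ex : exists n, 2 ^- n <= x.
  exists (Num.bound x^-1).
  rewrite -[leRHS]invrK lef_pV2 ?posrE ?exprn_gt0 ?invr_gt0//.
  have := archi_boundP (ltW (_ : 0 < x^-1)); rewrite invr_gt0 => /(_ x0) /ltW.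
  move=> /le_trans; apply; rewrite -natrX ler_nat; exact/ltnW/ltn_expl.
case: (ex_minnP ex) => i ix imin; exists i; split.
  case: i ix {imin} => [|[|//]].
    by rewrite expr0 invr1 => x1'; exfalso; lra.
  by rewrite expr1 leNgt x1.
rewrite in_itv/= ix/= ltNge; apply/negP => /imin.
case: i ix {imin} => [|i] ix; last by rewrite ltnn.
by move: ix; rewrite expr0 invr1 => x1'; exfalso; lra.
Qed.

Lemma itv01_cases x : x \in `[0, 1] ->
  [\/ x = 0, (exists i, (2 <= i)%N /\ x \in `[2 ^- i, 2 ^- i.-1[) |
      x \in `[2^-1, 1]].
Proof.
rewrite !in_itv/= => /andP[x0 x1].
have [xh|xh] := leP 2^-1 x; first by apply: Or33; rewrite x1.
move: x0; rewrite le_eqVlt => /predU1P[<-|x0]; first exact: Or31.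
by apply: Or32; apply: branchP; rewrite x0.
Qed.

Lemma phi_itv01 x : (2 <= k)%N -> x \in `[0, 1] -> phi k x \in `[0, 1].
Proof.
move=> k2 /itv01_cases[->|[i [i2 xi]]|xh].
- by rewrite phi_0 in_itv/= lexx ler01.
- rewrite (phi_branch i2 xi); move: xi; rewrite !in_itv/= => /andP[a b].
  have p0 : 0 < 2 ^+ i :> R by rewrite exprn_gt0.
  rewrite mulr_ge0 ?subr_ge0 ?(ltW p0)//= -ler_pdivlMl// mulr1 lerBlDr.
  rewrite (le_trans (ltW b))//.
  case: i i2 {a b p0} => // i _; rewrite exprS invfM/=.
  lra.
- rewrite (phi_upper xh); move: xh; rewrite !in_itv/= => /andP[a b].
  have p0 : 0 < 2 ^+ k :> R by rewrite exprn_gt0.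
  rewrite mulr_ge0 ?subr_ge0 ?divr_ge0 ?(ltW p0)//=.
  rewrite mulrAC ler_pdivrMr// mul1r (@le_trans _ _ 1)//; first lra.
  by rewrite exprn_ege1// ler1n.
Qed.

Lemma measurable_phi : measurable_fun (@I01 R) (@phi R k).
Proof.
pose E n : set R := if n is m.+1 then
  [set` if (2 <= m)%N then `[2 ^- m, 2 ^- m.-1[ else `[2^-1, 1]] else [set 0].
have mE n : measurable (E n) by case: n => [|n]//=; case: ifP.
apply: (@measurable_funS _ _ _ _ (\bigcup_n E n)).
- exact: bigcup_measurable.
- move=> x /itv01_cases[->|[i [i2 xi]]|xh].
  + by exists 0%N.
  + by exists i.+1 => //=; rewrite i2.
  + by exists 1%N.
apply/measurable_fun_bigcup => //.
case => [|n]/=; first exact: measurable_fun_set1.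
case: ifP => [n2|_].
  apply: (@eq_measurable_fun _ _ _ _ _ (fun x => 2 ^+ n * (x - 2 ^- n))).
    by move=> x /set_mem xn; rewrite (phi_branch n2).
  by apply: measurable_realfun.measurable_funM => //; apply: measurable_realfun.measurable_funB.
apply: (@eq_measurable_fun _ _ _ _ _ (fun x => 2 / 2 ^+ k * (x - 2^-1))).
  by move=> x /set_mem xh; rewrite phi_upper.
by apply: measurable_realfun.measurable_funM => //; apply: measurable_realfun.measurable_funB.
Qed.

End phi_spec.

(* Main.v *)
Require Import Defs.
From mathcomp Require Import all_boot all_order all_algebra.
From mathcomp Require Import all_classical all_reals all_analysis.
From mathcomp Require Import measurable_realfun ring lra.

Import Order.TTheory GRing.Theory Num.Theory.
Import numFieldNormedType.Exports.

Local Open Scope classical_set_scope.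
Local Open Scope ring_scope.

(* Let lambda be Lebesgue measure.  Each branch of phi on [2^-i, 2^(1-i)) is
   affine onto [0, 1), so lambda (phi^-1 A & [0, 2^-n)) = 2^-n lambda A, while
   the last branch contributes 2^(k-1) lambda (A & [0, 2^-k)); this makes rhok
   invariant.
   For uniqueness, let rho be an invariant density and B = {rho > rhok}.
   Comparing the integrals of rho - rhok over B and phi^-1 B shows that B is
   invariant up to a null set.  Then D x = lambda (B & [0, x)) - x lambda B
   vanishes at every 2^-n, and is self-similar on each branch with ratio at most
   1/4 (on [1/2, 1], where phi contracts, after a second step), so D = 0.
   By Lebesgue's density theorem B is null or conull, and since rho and rhok both
   have integral 1 they agree almost everywhere. *)

(** * Lebesgue measure under affine maps of the line *)

Section lebesgue_measure_affine.
Context {R : realType}.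
Local Notation mu := (@lebesgue_measure R).

Definition affine (c l x : R) : R := c * (x - l).

Lemma measurable_affine (c l : R) : measurable_fun [set: R] (affine c l).
Proof.
by apply: measurable_funM => //;
  apply: measurable_funB.
Qed.

Lemma measurable_affine_preimage (c l : R) (A : set R) :
  measurable A -> measurable (affine c l @^-1` A).
Proof.
by move=> mA; rewrite -[_ @^-1` _]setTI; exact: measurable_affine.
Qed.

(** The pushforward of [mu] under the affine map, scaled by [c], is a measure giving every []a, b]]
    its length, so it is [mu] by uniqueness of Lebesgue measure. *)
Lemma lebesgue_measure_affine (c l : R) (A : set R) : 0 < c -> measurable A ->
  mu (affine c l @^-1` A) = (c^-1%:E * mu A)%E.
Proof.
move=> c0 mA.
pose aff : measurableTypeR R -> measurableTypeR R := affine c l.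
have maff : measurable_fun setT aff := measurable_affine c l.
pose cn := NngNum (ltW c0).
pose m : {measure set (measurableTypeR R) -> \bar R} :=
  mscale cn (pushforward mu aff).
have mE X : m maff X = (c%:E * mu (affine c l @^-1` X))%E by [].
have -> : mu A = m maff A.
  apply: lebesgue_measure_unique => // _ [[a b]] _ <-.
  rewrite mE (_ : _ @^-1` _ = `](a / c + l), (b / c + l)]%classic); last first.
    apply/seteqP; split => x; rewrite /affine/= !in_itv/=;
      by rewrite -ltrBrDr -lerBlDr ltr_pdivrMr// ler_pdivlMr// mulrC.
  rewrite !lebesgue_measure_itv/= !lte_fin ltrD2r ltr_pM2r ?invr_gt0//.
  case: ifPn; last by rewrite mule0.
  by rewrite -!EFinB -EFinM => _; congr EFin; field; rewrite gt_eqF.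
by rewrite mE muleA -EFinM mulVf ?gt_eqF// mul1e.
Qed.

Lemma lebesgue_measure_setD1 (A : set R) (a : R) : measurable A ->
  mu (A `\ a) = mu A.
Proof.
move=> mA; have mA1 : measurable [set a] by exact: measurable_set1.
have /= -> := measureDI mu mA mA1; rewrite [X in (_ + X)%E](_ : _ = 0%E) ?adde0//.
apply/eqP; rewrite -measure_le0 -(lebesgue_measure_set1 a).
by apply: le_measure; rewrite ?inE//; exact: measurableI.
Qed.

End lebesgue_measure_affine.

(** * Real-valued Lebesgue measure restricted to [[0, 1)] *)

Section vol.
Context {R : realType}.
Local Notation mu := (@lebesgue_measure R).
Implicit Types A B : set R.

(* [0, 1[ and not [0, 1], to match the half-open branches of phi. *)
Definition vol A : R := fine (mu (A `&` `[0, 1[)).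

Lemma volE A : measurable A -> (vol A)%:E = mu (A `&` `[0, 1[).
Proof.
move=> mA; rewrite /vol fineK// ge0_fin_numE//.
apply: (@le_lt_trans _ _ (mu `[0, 1[)).
  by rewrite le_measure ?inE//; exact: measurableI.
by rewrite lebesgue_measure_itv/= lte_fin ltr01 oppr0 addr0 ltry.
Qed.

Lemma vol_ge0 A : 0 <= vol A.
Proof. by rewrite /vol fine_ge0. Qed.

Lemma le_vol A B : measurable A -> measurable B ->
  A `&` `[0, 1[ `<=` B -> vol A <= vol B.
Proof.
move=> mA mB AB; rewrite -lee_fin !volE// le_measure ?inE//.
- exact: measurableI.
- exact: measurableI.
- by move=> x Ax; split; [exact: AB|case: Ax].
Qed.

Lemma eq_vol A B : A `&` `[0, 1[ = B `&` `[0, 1[ -> vol A = vol B.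
Proof. by rewrite /vol => ->. Qed.

Lemma volU A B : measurable A -> measurable B -> A `&` B `<=` set0 ->
  vol (A `|` B) = vol A + vol B.
Proof.
move=> mA mB AB; apply: EFin_inj; rewrite EFinD !volE//; last first.
  exact: measurableU.
rewrite setIUl measureU//; [exact: measurableI|exact: measurableI|].
by apply/seteqP; split => // x [[? _] [? _]]; exact: AB.
Qed.

Lemma vol_itv (a b : R) : 0 <= a <= b -> b <= 1 -> vol `[a, b[ = b - a.
Proof.
move=> /andP[a0 ab] b1; rewrite /vol setIidl; last first.
  by move=> x/=; rewrite !in_itv/= => /andP[? ?]; apply/andP; split; lra.
rewrite lebesgue_measure_itv/= lte_fin; case: ltgtP ab => //.
by move=> -> _; rewrite subrr.
Qed.

Lemma vol_le1 A : measurable A -> vol A <= 1.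
Proof.
move=> mA; rewrite -(subr0 1) -vol_itv ?lexx ?ler01//.
by apply: le_vol => // x [].
Qed.

Lemma vol_affine (c l : R) A : 0 < c -> measurable A ->
  A `<=` `[0, 1[ -> affine c l @^-1` A `<=` `[0, 1[ ->
  vol (affine c l @^-1` A) = c^-1 * vol A.
Proof.
move=> c0 mA A01 pA01; apply: EFin_inj; rewrite EFinM !volE//; last first.
  exact: measurable_affine_preimage.
by rewrite setIidl// [A `&` _]setIidl// lebesgue_measure_affine.
Qed.

Lemma vol_split A (a b c : R) : measurable A -> a <= b <= c ->
  vol (A `&` `[a, c[) = vol (A `&` `[a, b[) + vol (A `&` `[b, c[).
Proof.
move=> mA /andP[ab bc].
rewrite -volU; [|exact: measurableI..|]; last first.
  by move=> x/=; rewrite !in_itv/= => -[[_ ?] [_ ?]]; lra.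
rewrite -setIUr -itv_bndbnd_setU//; by rewrite bnd_simp.
Qed.

End vol.

(** * Preimages under [phi] and their volumes *)

Section phi_vol.
Context {R : realType} (k : nat).
Local Notation mu := (@lebesgue_measure R).
Local Notation phi := (@phi R k).
Implicit Types (A S : set R) (t x : R).

Lemma half_pow_gt0 i : 0 < 2 ^- i :> R.
Proof. by rewrite invr_gt0 exprn_gt0. Qed.

Lemma half_powS i : 2 ^- i = 2 * 2 ^- i.+1 :> R.
Proof. by rewrite exprS invfM mulVKf// pnatr_eq0. Qed.

Lemma half_pow_pred i : (0 < i)%N -> 2 ^- i.-1 = 2 ^- i * 2 :> R.
Proof. by move=> i0; rewrite half_powS prednK// mulrC. Qed.

Lemma half_pow_le i j : (i <= j)%N -> 2 ^- j <= 2 ^- i :> R.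
Proof.
by move=> ij; rewrite lef_pV2 ?posrE ?exprn_gt0// ler_eXn2l ?ltr1n.
Qed.

Lemma half_pow_le1 i : 2 ^- i <= 1 :> R.
Proof. by have := half_pow_le _ _ (leq0n i); rewrite expr0 invr1. Qed.

Lemma eq0_half_pow x : (forall n, `|x| <= 2 ^- n) -> x = 0.
Proof.
move=> xn; apply/eqP; rewrite -normr_le0; apply/ler_addgt0Pl => d d0.
rewrite addr0 (le_trans (xn (Num.bound d^-1)))//.
rewrite -[leRHS]invrK lef_pV2 ?posrE ?exprn_gt0 ?invr_gt0//.
apply: (le_trans (ltW (archi_boundP (ltW _)))); rewrite ?invr_gt0//.
by rewrite -natrX ler_nat; exact/ltnW/ltn_expl.
Qed.

Lemma measurable_phi_preimage A S : measurable A -> measurable S ->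
  S `<=` @I01 R -> measurable (phi @^-1` A `&` S).
Proof.
move=> mA mS SI.
have -> : phi @^-1` A `&` S = (@I01 R `&` phi @^-1` A) `&` S.
  by rewrite [@I01 R `&` _]setIC -setIA (setIidr SI).
apply: measurableI => //.
by apply: (@measurable_phi R k) => //; exact: measurable_itv.
Qed.

(** The choice [t = 1] gives the whole branch. Initial segments of a branch, with general [t], are
    what the self-similarity of the distribution function of an invariant set requires. *)
Lemma phi_preimage_branch i t A : (2 <= i)%N -> t <= 1 ->
  phi @^-1` A `&` `[2 ^- i, 2 ^- i * (1 + t)[
  = affine (2 ^+ i) (2 ^- i) @^-1` (A `&` `[0, t[).
Proof.
move=> i2 t1; have p0 := half_pow_gt0 i.
have e0 : 0 < 2 ^+ i :> R by rewrite exprn_gt0.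
have Ei x : (x \in `[2 ^- i, 2 ^- i * (1 + t)[) =
            (affine (2 ^+ i) (2 ^- i) x \in `[0, t[).
  rewrite !in_itv/= /affine pmulr_rge0// subr_ge0; congr andb.
  by rewrite -[in RHS]ltr_pdivlMl// ltrBlDl mulrDr mulr1.
have phiE x : x \in `[2 ^- i, 2 ^- i * (1 + t)[ ->
    phi x = affine (2 ^+ i) (2 ^- i) x.
  rewrite in_itv/= => /andP[xl xr]; rewrite (phi_branch k i2)//.
  rewrite in_itv/= xl (lt_le_trans xr)//.
  by rewrite (half_pow_pred _ (ltnW i2)) ler_pM2l//; lra.
apply/seteqP; split => x /= -[Ax xi].
  by split; [rewrite -phiE|rewrite -Ei].
by split; [rewrite phiE// Ei|rewrite Ei].
Qed.

(** The last branch has slope [2 ^- k.-1] on an interval of length 1/2, so its values stay below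
    [2 ^- k]; hence the bound on [t]. *)
Lemma phi_preimage_upper t A : t <= 2 ^- k -> (0 < k)%N ->
  phi @^-1` A `&` `[2^-1, 2^-1 + 2 ^+ k.-1 * t[
  = affine (2 ^- k.-1) (2^-1) @^-1` (A `&` `[0, t[).
Proof.
move=> t1 k0; have p0 := half_pow_gt0 k.-1.
have Ei x : (x \in `[2^-1, 2^-1 + 2 ^+ k.-1 * t[) =
            (affine (2 ^- k.-1) 2^-1 x \in `[0, t[).
  rewrite !in_itv/= /affine pmulr_rge0// subr_ge0; congr andb.
  by rewrite ltr_pdivrMl ?exprn_gt0// ltrBlDl.
have phiE x : x \in `[2^-1, 2^-1 + 2 ^+ k.-1 * t[ ->
    phi x = affine (2 ^- k.-1) 2^-1 x.
  rewrite in_itv/= => /andP[xl xr]; rewrite phi_upper.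
    by rewrite /affine (half_powS k.-1) prednK.
  rewrite in_itv/= xl/= (le_trans (ltW xr))//.
  (* As [2 ^+ k.-1 * 2 ^- k] is 1/2, the right endpoint of the segment is at most 1. *)
  have : 2 ^+ k.-1 * t <= 2 ^+ k.-1 * 2 ^- k by rewrite ler_pM2l ?exprn_gt0.
  have := half_powS k.-1; rewrite prednK// => /(congr1 (fun y => 2 ^+ k.-1 * y)).
  by rewrite mulfV ?expf_neq0 ?pnatr_eq0//; lra.
apply/seteqP; split => x /= -[Ax xi].
  by split; [rewrite -phiE|rewrite -Ei].
by split; [rewrite phiE// Ei|rewrite Ei].
Qed.

Lemma vol_phi_branch i t A : measurable A -> (2 <= i)%N -> 0 <= t <= 1 ->
  vol (phi @^-1` A `&` `[2 ^- i, 2 ^- i * (1 + t)[)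
  = 2 ^- i * vol (A `&` `[0, t[).
Proof.
move=> mA i2 /andP[t0 t1]; rewrite phi_preimage_branch//.
rewrite vol_affine ?exprn_gt0//.
- exact: measurableI.
- by move=> x [_] /=; rewrite !in_itv/= => /andP[? ?]; lra.
- rewrite -phi_preimage_branch// => x [_] /=; rewrite !in_itv/= => /andP[xl xr].
  have p0 := half_pow_gt0 i; rewrite (le_trans (ltW p0))//=.
  rewrite (lt_le_trans xr)//.
  have : 2 ^- i * (1 + t) <= 2 ^- i * 2 by rewrite ler_pM2l//; lra.
  have := half_pow_le1 i.-1; rewrite (half_powS i.-1) prednK; last exact: ltnW.
  lra.
Qed.

Lemma vol_phi_upper t A : measurable A -> (0 < k)%N -> 0 <= t <= 2 ^- k ->
  vol (phi @^-1` A `&` `[2^-1, 2^-1 + 2 ^+ k.-1 * t[)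
  = 2 ^+ k.-1 * vol (A `&` `[0, t[).
Proof.
move=> mA k0 /andP[t0 t1]; rewrite phi_preimage_upper//.
have := half_pow_le1 k => k1.
rewrite vol_affine ?half_pow_gt0 ?invrK//.
- exact: measurableI.
- by move=> x [_] /=; rewrite !in_itv/= => /andP[? ?]; lra.
- rewrite -phi_preimage_upper// => x [_] /=; rewrite !in_itv/= => /andP[xl xr].
  have : 2 ^+ k.-1 * t <= 2 ^+ k.-1 * 2 ^- k by rewrite ler_pM2l ?exprn_gt0.
  have := half_powS k.-1; rewrite prednK// => /(congr1 (fun y => 2 ^+ k.-1 * y)).
  by rewrite mulfV ?expf_neq0 ?pnatr_eq0//; lra.
Qed.

(** The branches of index [i > n] fill []0, 2 ^- n[] and contribute [2 ^- i * vol A] each, a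
    geometric series. The proof telescopes over one branch at a time instead of summing the
    series. *)
Lemma vol_phi_dyadic n A : measurable A -> (0 < n)%N ->
  vol (phi @^-1` A `&` `[0, 2 ^- n[) = 2 ^- n * vol A.
Proof.
move=> mA n0.
pose L m := vol (phi @^-1` A `&` `[0, 2 ^- m[).
pose e m := L m - 2 ^- m * vol A.
have sub01 m : `[0, 2 ^- m[ `<=` @I01 R.
  move=> x; rewrite /I01/= !in_itv/= => /andP[-> xm] /=.
  by rewrite (le_trans (ltW xm)) ?half_pow_le1.
have mL m : measurable (phi @^-1` A `&` `[0, 2 ^- m[).
  by apply: measurable_phi_preimage => //; exact: sub01.
(* e is constant, since one branch accounts for L m - L m.+1, and tends to 0. *)
have eS m : (0 < m)%N -> e m.+1 = e m.
  move=> m0; rewrite /e.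
  suff -> : L m = L m.+1 + 2 ^- m.+1 * vol A by rewrite (half_powS m); ring.
  (* This form of [vol A] matches [vol_phi_branch] at [t = 1], which covers the full branch of index
     [m.+1]. *)
  rewrite /L; have -> : vol A = vol (A `&` `[0, 1[).
    by apply: eq_vol; rewrite -setIA setIid.
  rewrite -vol_phi_branch ?ler01 ?lexx// -volU.
  - rewrite -setIUr (_ : 1 + 1 = 2)// [2 ^- m.+1 * 2]mulrC -half_powS.
    by rewrite -itv_bndbnd_setU// !bnd_simp ?half_pow_le// ltW ?half_pow_gt0.
  - exact: mL.
  - apply: measurable_phi_preimage => // x; rewrite /I01/= !in_itv/=.
    rewrite (_ : 1 + 1 = 2)// [2 ^- m.+1 * 2]mulrC -half_powS => /andP[? ?].
    have := half_pow_gt0 m.+1; have := half_pow_le1 m => ? ?.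
    by apply/andP; split; lra.
  - by move=> x/=; rewrite !in_itv/= => -[[_ ?] [_ ?]]; lra.
(* Both terms of [e m] lie between 0 and [2 ^- m], hence so does the modulus of their difference. *)
have ele m : `|e m| <= 2 ^- m.
  have L0 : 0 <= L m by exact: vol_ge0.
  have Lm : L m <= 2 ^- m.
    rewrite /L -[leRHS]subr0 -vol_itv ?lexx ?half_pow_le1 ?(ltW (half_pow_gt0 m))//.
    by apply: le_vol => // x [[]].
  have : 0 <= 2 ^- m * vol A <= 2 ^- m.
    rewrite (mulr_ge0 (ltW (half_pow_gt0 m)) (vol_ge0 _))/=.
    by rewrite ler_piMr ?vol_le1// ltW// half_pow_gt0.
  by rewrite /e ler_norml => /andP[? ?]; lra.
have econst m : e (n + m)%N = e n.
  elim: m => [|m IH]; first by rewrite addn0.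
  by rewrite addnS eS ?IH// addn_gt0 n0.
suff : e n = 0 by move/eqP; rewrite subr_eq0 => /eqP.
apply: eq0_half_pow => m; rewrite -(econst m) (le_trans (ele _))//.
exact/half_pow_le/leq_addl.
Qed.

End phi_vol.

(** * The density [rhok] and its invariance *)

Section rhok.
Context {R : realType} (k : nat).
Hypothesis k2 : (2 <= k)%N.
Local Notation mu := (@lebesgue_measure R).
Local Notation phi := (@phi R k).
Local Notation rhok := (@rhok R k).
Implicit Types (A : set R) (x : R).

Lemma measurable_I01 : measurable (@I01 R).
Proof. exact: measurable_itv. Qed.

(** Only the point 1 can be lost by restricting to [[0, 1)], and it is null. *)
Lemma vol_I01E A : measurable A -> A `<=` @I01 R -> (vol A)%:E = mu A.
Proof.
move=> mA AI; rewrite volE// -(lebesgue_measure_setD1 _ 1 mA); congr (mu _).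
apply/seteqP; split => x [Ax]/=.
  by rewrite in_itv/= => /andP[_ x1]; split => //; apply/eqP; rewrite lt_eqF.
move=> /eqP x1; split => //; have := AI _ Ax.
by rewrite /I01/= !in_itv/= lt_neqAle x1 => /andP[-> ->].
Qed.

(** Writing [rhok] as a constant plus a multiple of one indicator turns its integrals into
    combinations of two volumes. *)
Lemma rhokE x : x \in `[0, 1] ->
  rhok x = 2 / 3 + 2 ^+ k / 3 * \1_(`[0, 2 ^- k[%classic : set R) x.
Proof.
move=> xI; rewrite /rhok indicE mem_setE.
case: ifPn => [_|x1]; first by rewrite mulr1; ring.
rewrite mulr0 addr0; case: ifPn => // x2; case: ifPn => // x3; exfalso.
move: xI x1 x2 x3; rewrite !in_itv/= => /andP[-> ->]/=.
by rewrite andbT -!leNgt => ->/=; rewrite -leNgt => ->.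
Qed.

Lemma measurable_rhok : measurable_fun (@I01 R) rhok.
Proof.
apply: (@eq_measurable_fun _ _ _ _ _
    (fun x : R => 2 / 3 + 2 ^+ k / 3 * \1_(`[0, 2 ^- k[%classic : set R) x : R)).
  by move=> x /set_mem xI; rewrite rhokE.
apply: measurable_funD => //.
by apply: measurable_funM => //.
Qed.

Lemma rhok_gt0 x : x \in `[0, 1] -> 0 < rhok x.
Proof.
by move=> xI; rewrite rhokE// ltr_wpDr ?divr_gt0//.
Qed.

Lemma integral_rhok A : measurable A -> A `<=` @I01 R ->
  (\int[mu]_(x in A) (rhok x)%:E =
   (2 / 3 * vol A + 2 ^+ k / 3 * vol (A `&` `[0%R, 2 ^- k[))%:E)%E.
Proof.
move=> mA AI.
have c0 : 0 <= 2 ^+ k / 3 :> R by rewrite divr_ge0 ?exprn_ge0.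
transitivity (\int[mu]_(x in A) ((2 / 3)%:E +
   (2 ^+ k / 3)%:E * (\1_(`[0, 2 ^- k[%classic : set R) x)%:E))%E.
  by apply: eq_integral => x /set_mem Ax; rewrite rhokE//; exact: AI.
have mind : measurable_fun A (\1_(`[0, 2 ^- k[%classic : set R) : R -> R).
  exact: measurable_indic.
move/measurable_EFinP in mind.
rewrite ge0_integralD//.
- rewrite integral_cst// ge0_integralZl_EFin//.
    rewrite integral_indic// EFinD !EFinM !vol_I01E//.
    + by rewrite setIC.
    + exact: measurableI.
    + by move=> x [Ax _]; exact: AI.
- exact: emeasurable_funM.
Qed.

(** The first summand comes from the branches below 1/2, by [vol_phi_dyadic] at [n = 1], and the
    second from the contracting branch on [[1/2, 1]]. *)
Lemma vol_phi_preimage A : measurable A ->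
  vol (@I01 R `&` phi @^-1` A) =
  2^-1 * vol A + 2 ^+ k.-1 * vol (A `&` `[0, 2 ^- k[).
Proof.
move=> mA; have k0 : (0 < k)%N := ltnW k2.
have Ek : 2^-1 + 2 ^+ k.-1 * 2 ^- k = 1 :> R.
  by rewrite -{2}(prednK k0) exprS; field; rewrite expf_neq0.
have h0 := half_pow_gt0 1 : 0 < 2 ^- 1 :> R.
rewrite -(vol_phi_upper k (2 ^- k) A) ?lexx ?(ltW (half_pow_gt0 _))// Ek.
have := vol_phi_dyadic k 1 A mA erefl; rewrite expr1 => <-.
have mp (a b : R) : 0 <= a -> b <= 1 ->
    measurable (phi @^-1` A `&` `[a, b[).
  move=> a0 b1; apply: measurable_phi_preimage => // x; rewrite /I01/= !in_itv/=.
  by move=> /andP[? ?]; apply/andP; split; lra.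
rewrite -volU; [| |by apply: mp; lra|].
- rewrite -setIUr -itv_bndbnd_setU ?bnd_simp//; last by lra.
  apply: eq_vol; rewrite -[RHS]setIA setIid.
  apply/seteqP; split => x /= [+ xI]; first by case.
  split=> //; split=> //; move: xI; rewrite /I01/= !in_itv/=.
  by move=> /andP[-> /ltW ->].
- by apply: mp; lra.
- by move=> x/=; rewrite !in_itv/= => -[[_ ?] [_ ?]]; lra.
Qed.

(** With [v = vol A] and [w] the volume of [A] below [2 ^- k], the preimage has integral [2/3 * (v/2
    + 2 ^+ k.-1 * w) + 2 ^+ k / 3 * (2 ^- k * v)], which equals [2/3 * v + 2 ^+ k / 3 * w], the
    integral over [A]. *)
Lemma invariant_rhok : invariant_density phi rhok.
Proof.
have k0 : (0 < k)%N := ltnW k2.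
have p0 : (2 ^+ k : R) != 0 by rewrite expf_neq0.
split; first split.
- exact: measurable_rhok.
- by move=> x xI; exact/ltW/rhok_gt0.
- rewrite integral_rhok//; last exact: measurable_I01.
  have -> : vol (@I01 R) = 1.
    rewrite -[RHS]subr0 -vol_itv ?lexx ?ler01//; apply: eq_vol.
    rewrite setIid; apply: setIidr => x; rewrite /I01/= !in_itv/=.
    by move=> /andP[-> /ltW ->].
  have -> : vol (@I01 R `&` `[0, 2 ^- k[) = 2 ^- k.
    rewrite -[RHS]subr0 -vol_itv ?lexx ?(ltW (half_pow_gt0 _)) ?half_pow_le1//.
    apply: eq_vol; congr (_ `&` _); apply: setIidr => x.
    rewrite /I01/= !in_itv/= => /andP[-> xk]/=.
    exact: le_trans (ltW xk) (half_pow_le1 k).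
  by congr EFin; field.
move=> A mA AI.
have mPA : measurable (@I01 R `&` phi @^-1` A).
  by apply: (@measurable_phi R k) => //; exact: measurable_itv.
rewrite !integral_rhok//.
congr EFin; rewrite vol_phi_preimage//.
have -> : vol (@I01 R `&` phi @^-1` A `&` `[0, 2 ^- k[) = 2 ^- k * vol A.
  rewrite -(vol_phi_dyadic k)//; congr vol; rewrite -setIA; apply: setIidr.
  move=> x [_]; rewrite /I01/= !in_itv/= => /andP[-> xk]/=.
  exact: le_trans (ltW xk) (half_pow_le1 k).
have E : 2 ^+ k = 2 * 2 ^+ k.-1 :> R by rewrite -exprS prednK.
by set w := vol (A `&` _); rewrite E; field; rewrite expf_neq0.
Qed.

End rhok.

(** * Self-similarity of a set that is invariant up to a null set *)

Section almost_invariant.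
Context {R : realType} (k : nat) (B : set R).
Hypotheses (k2 : (2 <= k)%N) (mB : measurable B).
Local Notation mu := (@lebesgue_measure R).
Local Notation phi := (@phi R k).
(** This expresses through volumes that [B] and its preimage agree up to a null set inside
    [[0, 1)]. *)
Hypothesis invB : forall S : set R, measurable S -> S `<=` `[0, 1[ ->
  vol (B `&` S) = vol (phi @^-1` B `&` S).

Let D (x : R) : R := vol (B `&` `[0, x[) - x * vol B.

Let D0 : D 0 = 0.
Proof.
rewrite /D mul0r subr0 (_ : _ `&` _ = set0) ?/vol ?set0I ?measure0//.
by apply/seteqP; split => // x [_]; rewrite /= in_itv/= => /andP[? ?]; lra.
Qed.

Let D1 : D 1 = 0.
Proof.
rewrite /D mul1r; apply/eqP; rewrite subr_eq0; apply/eqP/eq_vol.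
by rewrite -setIA setIid.
Qed.

(** This amounts to [D (2 ^- n) = 0]: [B] may be replaced by its preimage, to which [vol_phi_dyadic]
    applies. *)
Let D_dyadic n : (0 < n)%N ->
  vol (B `&` `[0, 2 ^- n[) = 2 ^- n * vol B.
Proof.
move=> n0; rewrite invB ?vol_phi_dyadic// => x /=; rewrite !in_itv/=.
by move=> /andP[-> xn]/=; exact: lt_le_trans (half_pow_le1 n).
Qed.

(** Splitting at [2 ^- i], the left part cancels by [D_dyadic] and the right part is carried by the
    branch to [[0, t[]. *)
Let D_branch i t : (2 <= i)%N -> 0 <= t <= 1 ->
  D (2 ^- i * (1 + t)) = 2 ^- i * D t.
Proof.
move=> i2 /[dup] t01 /andP[t0 t1]; have p0 := @half_pow_gt0 R i.
have i0 : (0 < i)%N := ltnW i2.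
rewrite /D (vol_split _ 0 (2 ^- i))//; last first.
  by rewrite (ltW p0)/= ler_peMr ?lerDl// ltW.
rewrite D_dyadic// invB//; first by rewrite vol_phi_branch//; ring.
move=> x /=; rewrite !in_itv/= => /andP[xl xr].
rewrite (le_trans (ltW p0))//= (lt_le_trans xr)//.
apply: (le_trans _ (@half_pow_le1 R i.-1)).
by rewrite (half_pow_pred i i0) ler_pM2l//; lra.
Qed.

(** The argument is that of [D_branch] with the split at 1/2. Since [phi] contracts here, the factor
    exceeds 1 and has to be compensated by a further branch. *)
Let D_upper t : 0 <= t <= 2 ^- k ->
  D (2^-1 + 2 ^+ k.-1 * t) = 2 ^+ k.-1 * D t.
Proof.
move=> /[dup] t01 /andP[t0 t1].
have k0 : (0 < k)%N := ltnW k2.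
have p0 : 0 < 2 ^+ k.-1 :> R by rewrite exprn_gt0.
rewrite /D (vol_split _ 0 2^-1)//; last first.
  by rewrite lerDl (mulr_ge0 (ltW p0) t0) andbT; lra.
have := D_dyadic 1 erefl; rewrite expr1 => ->.
rewrite invB//; first by rewrite vol_phi_upper//; ring.
move=> x /=; rewrite !in_itv/= => /andP[xl xr]; apply/andP; split; first lra.
rewrite (lt_le_trans xr)//.
have : 2 ^+ k.-1 * t <= 2 ^+ k.-1 * 2 ^- k by rewrite ler_pM2l.
have -> : 2 ^+ k.-1 * 2 ^- k = 2^-1 :> R.
  by rewrite -[in 2 ^- k](prednK k0) exprS; field; rewrite expf_neq0.
lra.
Qed.

(** A branch of index [i >= 2] yields the factor [2 ^- i], at most 1/4. A point of [[1/2, 1[] is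
    first sent to some [t < 2 ^- k]; if [t] is nonzero it lies in a branch of index [j > k], and the
    two factors multiply to [2 ^+ k.-1 * 2 ^- j], again at most 1/4. *)
Let D_contract M : 0 <= M ->
  (forall x, 0 <= x <= 1 -> `|D x| <= M) ->
  forall x, 0 <= x <= 1 -> `|D x| <= M / 4.
Proof.
move=> M0 DM x x01.
have M4 : 0 <= M / 4 by lra.
have k0 : (0 < k)%N := ltnW k2.
have pow4 i : (2 <= i)%N -> 2 ^- i <= 4^-1 :> R.
  move=> i2; apply: (le_trans (@half_pow_le R _ _ i2)).
  by rewrite (_ : 2 ^+ 2 = 4)//; ring.
have D_itv i y : (2 <= i)%N -> y \in `[2 ^- i, 2 ^- i.-1[ ->
    exists2 t, 0 <= t <= 1 & D y = 2 ^- i * D t.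
  move=> i2; rewrite in_itv/= (half_pow_pred i (ltnW i2)) => /andP[yl yr].
  have p0 := @half_pow_gt0 R i.
  exists (y / 2 ^- i - 1).
    rewrite subr_ge0 ler_pdivlMr// mul1r yl/= lerBlDr ler_pdivrMr//.
    by rewrite (_ : 1 + 1 = 2)// mulrC ltW.
  rewrite -D_branch//.
    by congr D; rewrite addrC subrK mulrC divfK ?gt_eqF.
  rewrite subr_ge0 ler_pdivlMr// mul1r yl/= lerBlDr ler_pdivrMr//.
  by rewrite (_ : 1 + 1 = 2)// mulrC ltW.
have : x \in `[0, 1] by rewrite in_itv.
move=> /itv01_cases[->|[i [i2 xi]]|].
- by rewrite D0 normr0.
- have [t t01 ->] := D_itv _ _ i2 xi.
  rewrite normrM gtr0_norm ?half_pow_gt0// mulrC.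
  by apply: ler_pM => //; [exact: DM|exact: pow4].
(* The point 1 is set apart because it corresponds to [t = 2 ^- k], in the branch of index [k],
   where the combined factor would only be 1/2. *)
rewrite in_itv/= => /andP[xl]; rewrite le_eqVlt => /predU1P[->|x1].
  by rewrite D1 normr0.
have p0 : 0 < 2 ^+ k.-1 :> R by rewrite exprn_gt0.
pose t := (x - 2^-1) / 2 ^+ k.-1.
have xE : x = 2^-1 + 2 ^+ k.-1 * t.
  by rewrite /t mulrC divfK ?gt_eqF//; ring.
have tk : t < 2 ^- k.
  rewrite /t ltr_pdivrMr// -[in 2 ^- k](prednK k0) exprS invfM -mulrA mulVf ?gt_eqF//.
  by lra.
have t0 : 0 <= t by rewrite divr_ge0 ?(ltW p0)// subr_ge0.
rewrite xE D_upper ?t0 ?(ltW tk)//.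
move: t0; rewrite le_eqVlt => /predU1P[<-|t0].
  by rewrite D0 mulr0 normr0.
have th : t < 2^-1.
  by rewrite (lt_le_trans tk)//; have := @half_pow_le R _ _ k0; rewrite expr1.
have [j [j2 tj]] := @branchP R t (introT andP (conj t0 th)).
have kj : (k < j)%N.
  rewrite ltnNge; apply/negP => jk; move: tj; rewrite in_itv/= => /andP[tj _].
  by have := le_lt_trans (le_trans (@half_pow_le R _ _ jk) tj) tk; rewrite ltxx.
have [s s01 ->] := D_itv _ _ j2 tj.
rewrite mulrA normrM gtr0_norm ?mulr_gt0 ?half_pow_gt0// mulrC.
apply: ler_pM => //; first exact: DM.
have -> : 2 ^+ k.-1 * 2 ^- j = 2 ^- (j - k.-1) :> R.
  rewrite -{1}(@subnK k.-1 j); last by rewrite (leq_trans (leq_pred _))// ltnW.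
  by rewrite exprD invfM mulrCA mulfV ?gt_eqF// mulr1.
apply: pow4; rewrite leq_subRL; first by rewrite addn2 prednK.
by rewrite (leq_trans (leq_pred _))// ltnW.
Qed.

(** Iterating [D_contract] from the trivial bound 1 bounds [D] by [4 ^- n] for every [n], so [D]
    vanishes. The bound is written [(2 ^- n) ^+ 2] to stay with powers of 2. *)
Lemma vol_almost_invariant (t : R) : 0 <= t <= 1 ->
  vol (B `&` `[0, t[) = t * vol B.
Proof.
have D_le n : forall x : R, 0 <= x <= 1 -> `|D x| <= (2 ^- n) ^+ 2.
  elim: n => [|n IH] x x01; last first.
    rewrite (_ : _ ^+ 2 = (2 ^- n) ^+ 2 / 4).
      by apply: D_contract => //; rewrite sqr_ge0.
    by rewrite [2 ^+ n.+1]exprS; field; rewrite expf_neq0.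
  have [v0 v1] := (vol_ge0 B, vol_le1 _ mB).
  have mBx : measurable (B `&` `[0, x[) by exact: measurableI.
  have [w0 w1] := (vol_ge0 (B `&` `[0, x[), vol_le1 _ mBx).
  have /andP[x0 x1] := x01.
  have : 0 <= x * vol B <= 1 by rewrite mulr_ge0//= mulr_ile1.
  rewrite expr0 invr1 expr1n /D ler_norml => /andP[? ?].
  by apply/andP; split; lra.
move=> t01; suff : D t = 0 by move/eqP; rewrite subr_eq0 => /eqP.
apply: eq0_half_pow => n; rewrite (le_trans (D_le n _ t01))//.
by rewrite expr2 ler_piMl ?half_pow_le1// ltW// half_pow_gt0.
Qed.

End almost_invariant.

(** * Real integrals on null sets and on the superlevel set of a difference *)

Section superlevel.
Context d (T : measurableType d) (R : realType).
Variable mu : {measure set T -> \bar R}.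
Implicit Types (f g : T -> R) (X Y D P : set T).

Lemma Rintegral_null f X : measurable X -> measurable_fun X f -> mu X = 0%E ->
  \int[mu]_(x in X) f x = 0.
Proof.
by move=> mX mf X0; rewrite /Rintegral null_set_integral//; exact/measurable_EFinP.
Qed.

Lemma Rintegral_setID f X Y : measurable X -> measurable Y ->
  mu.-integrable X (EFin \o f) ->
  \int[mu]_(x in X) f x = \int[mu]_(x in X `&` Y) f x +
                          \int[mu]_(x in X `\` Y) f x.
Proof.
move=> mX mY intf; rewrite -[in LHS](setUIDK X Y) Rintegral_setU//.
- exact: measurableI.
- exact: measurableD.
- by rewrite setUIDK.
- by apply/disj_set2P/seteqP; split => // x [[_ Yx] [_]].
Qed.

Lemma Rintegral_eq0_ae f X : measurable X -> mu.-integrable X (EFin \o f) ->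
  (forall x, X x -> 0 <= f x) -> \int[mu]_(x in X) f x = 0 ->
  \forall x \ae mu, X x -> f x = 0.
Proof.
move=> mX intf f0 int0.
have : (\int[mu]_(x in X) `|(EFin \o f) x| = 0)%E.
  rewrite (eq_integral (EFin \o f)); last first.
    by move=> x /set_mem Xx; rewrite /= ger0_norm ?f0.
  rewrite -[LHS]fineK; last exact: integrable_fin_num.
  exact: congr1 int0.
move=> /(ae_eq_integral_abs mu mX (measurable_int _ intf)).
by apply: filterS => x /[apply] -[].
Qed.

Lemma Rintegral_eq0_null f X : measurable X -> mu.-integrable X (EFin \o f) ->
  (forall x, X x -> 0 < f x) -> \int[mu]_(x in X) f x = 0 -> mu X = 0%E.
Proof.
move=> mX intf f0 int0; apply/(negligibleP _ mX).
have [|N [mN N0 XN]] := Rintegral_eq0_ae _ _ mX intf _ int0.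
  by move=> x Xx; exact/ltW/f0.
exists N; split => // x Xx; apply: XN => /(_ Xx) fx0.
by have := f0 _ Xx; rewrite fx0 ltxx.
Qed.

Lemma integrableS_subr f g D X : measurable D -> measurable X -> X `<=` D ->
  mu.-integrable D (EFin \o f) -> mu.-integrable D (EFin \o g) ->
  mu.-integrable X (EFin \o (f \- g)).
Proof.
move=> mD mX XD intf intg.
have := integrableB mX (integrableS mD mX XD intf) (integrableS mD mX XD intg).
exact: eq_integrable.
Qed.

(* With [B = {f > g}], [f - g] is positive on [B \ P] and nonpositive on
   [P \ B], while both sets have the same integral of [f - g]. *)
Lemma superlevel_symdiff_null f g D P : measurable D -> measurable P ->
  P `<=` D ->
  mu.-integrable D (EFin \o f) -> mu.-integrable D (EFin \o g) ->
  (forall x, D x -> 0 < g x) ->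
  let B := D `&` [set x | g x < f x] in measurable B ->
  \int[mu]_(x in P) f x = \int[mu]_(x in B) f x ->
  \int[mu]_(x in P) g x = \int[mu]_(x in B) g x ->
  mu (B `\` P) = 0%E /\ mu (P `\` B) = 0%E.
Proof.
move=> mD mP PD intf intg g0 B mB Ef Eg.
have BD : B `<=` D by move=> x [].
have mBP : measurable (B `\` P) by exact: measurableD.
have mPB : measurable (P `\` B) by exact: measurableD.
have BPD : B `\` P `<=` D by move=> x [/BD].
have PBD : P `\` B `<=` D by move=> x [/PD].
have intS h X : mu.-integrable D (EFin \o h) -> measurable X -> X `<=` D ->
    mu.-integrable X (EFin \o h).
  by move=> inth mX XD; exact: (integrableS mD mX XD inth).
(* Cancelling the common part of [P] and [B] transfers the equality of integrals to the two set
   differences. *)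
have diffE h : mu.-integrable D (EFin \o h) ->
    \int[mu]_(x in P) h x = \int[mu]_(x in B) h x ->
    \int[mu]_(x in P `\` B) h x = \int[mu]_(x in B `\` P) h x.
  move=> inth; rewrite (Rintegral_setID _ _ B mP mB) ?(Rintegral_setID _ _ P mB mP).
  - by rewrite setIC => /addrI.
  - exact: intS.
  - exact: intS.
have Ef' := diffE f intf Ef; have Eg' := diffE g intg Eg.
have f_le_g : \int[mu]_(x in P `\` B) f x <= \int[mu]_(x in P `\` B) g x.
  apply: le_Rintegral => //; [exact: intS|exact: intS|].
  move=> x [Px nBx]; rewrite leNgt; apply/negP => gf.
  by apply: nBx; split => //; exact: PD.
have BP0 : mu (B `\` P) = 0%E.
  apply: (Rintegral_eq0_null (f \- g)) => //.
  - exact: integrableS_subr intf intg.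
  - by move=> x [[_ gf] _]; rewrite subr_gt0.
  - apply/eqP; rewrite eq_le; apply/andP; split.
      by rewrite RintegralB ?subr_le0 -?Ef' -?Eg'//; exact: intS.
    apply: Rintegral_ge0 => x [[_ gf] _].
    by rewrite subr_ge0 ltW.
(* The integral of [g] over [P] minus [B] equals the one over [B] minus [P], now known to be null;
   positivity of [g] then makes the former set null. *)
split => //; apply: (Rintegral_eq0_null g) => //.
- exact: intS.
- by move=> x /PBD; exact: g0.
- rewrite Eg' Rintegral_null//.
  have /measurable_int := intS g _ intg mBP BPD.
  by move/measurable_EFinP.
Qed.

End superlevel.

(** * A zero-one law from Lebesgue's density theorem *)

Section zero_one.
Context {R : realType}.
Local Notation mu := (@lebesgue_measure R).

(** Balls are open intervals while [vol] is computed on half-open ones; the extra point [a] is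
    null. *)
Lemma vol_itvoo (B : set R) (a b : R) : measurable B -> 0 <= a -> a < b ->
  b <= 1 -> mu (B `&` `]a, b[) = (vol (B `&` `[a, b[))%:E.
Proof.
move=> mB a0 ab b1.
have sub01 : `[a, b[ `<=` @I01 R.
  move=> x; rewrite /I01/= !in_itv/= => /andP[? ?]; apply/andP; split; lra.
apply/esym; rewrite vol_I01E; [|exact: measurableI|by move=> x [_ /sub01]].
rewrite -[LHS](lebesgue_measure_setD1 _ a); last exact: measurableI.
congr (mu _); apply/seteqP; split => x /=; rewrite !in_itv/=.
  by move=> [[Bx /andP[ax ->]] /eqP xa]; rewrite lt_neqAle eq_sym xa ax.
move=> [Bx /andP[ax ->]]; rewrite (ltW ax); split => //.
by apply/eqP; rewrite gt_eqF.
Qed.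

(** The relative measure of [B] in every small ball around a point of []0, 1[] is exactly [vol B].
    At a density point its limit is a value of the indicator of [B], hence 0 or 1. *)
Lemma vol_zero_one (B : set R) : measurable B ->
  (forall t : R, 0 <= t <= 1 -> vol (B `&` `[0, t[) = t * vol B) ->
  vol B = 0 \/ vol B = 1.
Proof.
move=> mB volB.
have [N [mN N0 BN]] := lebesgue_density mB.
(* The exceptional set [N] is null, so it cannot contain the interval []0, 1[] of measure 1. *)
have [x x01 Nx] : exists2 x : R, x \in `]0, 1[ & ~ N x.
  apply: contrapT => noX.
  have : (mu `]0%R, 1%R[ <= mu N)%E.
    apply: le_measure; rewrite ?inE//.
    by move=> x x01; apply: contrapT => Nx; apply: noX; exists x.
  by rewrite N0 lebesgue_measure_itv/= lte_fin ltr01 oppr0 adde0 lee_fin ler10.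
have {}BN : (mu (B `&` ball x r) * (mu (ball x r))^-1)%E
    @[r --> 0^'+] --> (\1_B x)%:E.
  by apply: contrapT => nB; apply: Nx; exact: BN.
move: x01; rewrite in_itv/= => /andP[x0 x1].
suff : (vol B)%:E = (\1_B x)%:E :> \bar R.
  by move=> [->]; rewrite indicE; case: (_ \in _); [right|left].
apply: (@cvg_unique _ (@ereal_hausdorff R) _ _ _ _ _ BN).
apply: cvg_near_cst; near=> r.
have r0 : 0 < r by near: r; exact: nbhs_right_gt.
have rx : r < x by near: r; exact: nbhs_right_lt.
have r1 : r < 1 - x by near: r; apply: nbhs_right_lt; rewrite subr_gt0.
rewrite lebesgue_measure_ball ?ltW// ball_itv vol_itvoo//; [|lra..].
have : vol (B `&` `[x - r, x + r[) = r *+ 2 * vol B.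
  have xr : 0 <= x - r <= x + r by apply/andP; split; lra.
  have := vol_split B 0 (x - r) (x + r) mB xr.
  rewrite !volB; [|by apply/andP; split; lra..].
  by rewrite mulr2n; lra.
move=> ->; rewrite inver mulrn_eq0/= gt_eqF//.
by rewrite -EFinM mulrAC mulfV ?mul1r// mulrn_eq0/= gt_eqF.
Unshelve. all: by end_near. Qed.

End zero_one.

(** * Uniqueness of the invariant density *)

Section uniqueness.
Context {R : realType} (k : nat).
Hypothesis k2 : (2 <= k)%N.
Local Notation mu := (@lebesgue_measure R).
Local Notation phi := (@phi R k).
Local Notation rhok := (@rhok R k).

Lemma probability_density_integrable (rho : R -> R) :
  probability_density rho -> mu.-integrable (@I01 R) (EFin \o rho).
Proof.
move=> [mrho rho0 int1]; apply/integrableP; split; first exact/measurable_EFinP.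
rewrite [ltLHS](_ : _ = 1%E) ?ltry// -int1; apply: eq_integral => x /set_mem xI.
by rewrite /= ger0_norm ?rho0.
Qed.

(** Adjoining the null set [A] minus [B] to the right-hand set keeps its volume and makes it contain
    the left-hand one. *)
Lemma le_vol_null (A B S : set R) : measurable A -> measurable B ->
  measurable S -> mu (A `\` B) = 0%E -> vol (A `&` S) <= vol (B `&` S).
Proof.
move=> mA mB mS AB0.
have mAB : measurable (A `\` B) by exact: measurableD.
have mBS : measurable (B `&` S) by exact: measurableI.
have -> : vol (B `&` S) = vol ((B `&` S) `|` (A `\` B)).
  rewrite volU//; last by move=> x [[Bx _] [_]].
  have AB01 : mu ((A `\` B) `&` `[0, 1[) = 0%E.
    apply/eqP; rewrite -measure_le0 -AB0.
    by apply: le_measure; rewrite ?inE//; exact: measurableI.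
  by rewrite [vol (_ `\` _)]/vol AB01 addr0.
apply: le_vol; [exact: measurableI|exact: measurableU|].
by move=> x [[Ax Sx] _]; have [Bx|nBx] := pselect (B x); [left|right].
Qed.

Lemma invariant_density_unique (rho : R -> R) : invariant_density phi rho ->
  rho = rhok %[ae mu in @I01 R].
Proof.
move=> [drho inv_rho]; have [drhok inv_rhok] := @invariant_rhok R k k2.
have int_rho := probability_density_integrable _ drho.
have int_rhok := probability_density_integrable _ drhok.
have [mrho _ rho1] := drho; have [mrhok _ rhok1] := drhok.
have mI := measurable_I01 : measurable (@I01 R).
pose B := @I01 R `&` [set x | rhok x < rho x].
have BI : B `<=` @I01 R by move=> x [].
have mB : measurable B.
  have := measurable_funB mrho mrhok => /(_ mI `]0, +oo[%classic).
  rewrite (_ : _ `&` _ = B); first by apply; exact: measurable_itv.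
  by apply/seteqP; split => x [Ix]/=; rewrite in_itv/= andbT subr_gt0.
pose P := @I01 R `&` phi @^-1` B.
have mP : measurable P.
  by apply: (@measurable_phi R k) => //; exact: measurable_itv.
have [BP0 PB0] : mu (B `\` P) = 0%E /\ mu (P `\` B) = 0%E.
  apply: (@superlevel_symdiff_null _ _ R mu rho rhok _ P mI mP _ _ _ _ mB) => //.
  - by move=> x [].
  - by move=> x xI; apply: rhok_gt0.
  - by rewrite /Rintegral inv_rho.
  - by rewrite /Rintegral inv_rhok.
have volB : vol B = 0 \/ vol B = 1.
  apply: vol_zero_one => //; apply: (vol_almost_invariant k) => // S mS S01.
  (* [P] is the preimage cut down to [[0, 1]], which changes nothing inside [S]. *)
  have -> : phi @^-1` B `&` S = P `&` S.
    apply/seteqP; split => x [] => [Bx Sx|[_ Bx] Sx]; split => //; split => //.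
    have := S01 _ Sx; rewrite /I01/= !in_itv/=.
    by move=> /andP[-> /ltW ->].
  by apply/eqP; rewrite eq_le !le_vol_null.
pose d := rho \- rhok.
have int_d X : measurable X -> X `<=` @I01 R -> mu.-integrable X (EFin \o d).
  by move=> mX XI; apply: (@integrableS_subr _ _ R mu rho rhok (@I01 R)).
have md X : measurable X -> X `<=` @I01 R -> measurable_fun X d.
  by move=> mX XI; have /measurable_int/measurable_EFinP := int_d X mX XI.
have mIB : measurable (@I01 R `\` B) by exact: measurableD.
have IBI : @I01 R `\` B `<=` @I01 R by move=> x [].
have dI : \int[mu]_(x in B) d x + \int[mu]_(x in @I01 R `\` B) d x = 0.
  have := @Rintegral_setID _ _ R mu d (@I01 R) B mI mB (int_d _ mI (@subset_refl _ _)).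
  rewrite (setIidr BI) => <-.
  by rewrite RintegralB// /Rintegral rho1 rhok1 subrr.
(* If [B] is null, then [d] has integral 0 over the complement of [B], where it is nonpositive, so
   it vanishes almost everywhere. *)
case: volB => volB.
  have B0 : mu B = 0%E by rewrite -vol_I01E// volB.
  move: dI; rewrite Rintegral_null ?add0r; [|exact: mB|exact: md|exact: B0].
  move=> dIB.
  have : \forall x \ae mu, (@I01 R `\` B) x -> (rhok \- rho) x = 0.
    apply: (@Rintegral_eq0_ae _ _ R mu) => //.
    - exact: (@integrableS_subr _ _ R mu rhok rho (@I01 R)).
    - move=> x [xI nBx]; rewrite subr_ge0 leNgt; apply/negP => rx.
      by apply: nBx.
    - have intS f : mu.-integrable (@I01 R) (EFin \o f) ->
          mu.-integrable (@I01 R `\` B) (EFin \o f).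
        exact: (@integrableS _ _ R mu).
      move: dIB; rewrite !(@RintegralB _ _ R mu) ?intS// => /eqP.
      by rewrite subr_eq0 => /eqP ->; rewrite subrr.
  have : \forall x \ae mu, ~ B x.
    by exists B; split => // x /= /contrapT.
  have := ae_filter_ringOfSetsType mu => ?; apply: filterS2 => x nBx dx xI.
  by apply/esym/eqP; rewrite -subr_eq0; apply/eqP/dx.
(* If [B] is conull, then [d] has integral 0 over [B] while being positive there, which forces [B]
   to be null. *)
exfalso.
have IB0 : mu (@I01 R `\` B) = 0%E.
  rewrite -vol_I01E//; congr EFin; apply/eqP; rewrite eq_le vol_ge0 andbT.
  have := vol_le1 _ mI; rewrite -{1}(setDUK BI) volU//; first by rewrite volB; lra.
  by move=> x [Bx []].
move: dI; rewrite [X in _ + X]Rintegral_null ?addr0; [|exact: mIB|exact: md|exact: IB0].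
move=> dB.
have : mu B = 0%E.
  apply: (@Rintegral_eq0_null _ _ R mu d) => //; first exact: int_d.
  by move=> x [_ ?]; rewrite subr_gt0.
by rewrite -vol_I01E// volB => -[] /eqP; rewrite oner_eq0.
Qed.

End uniqueness.

Theorem proposition2 (R : realType) (k : nat) (hk : (2 <= k)%N) :
  invariant_density (@phi R k) (@rhok R k) /\
  forall rho : R -> R, invariant_density (@phi R k) rho ->
    rho = @rhok R k %[ae lebesgue_measure in @I01 R].
Proof.
split; first exact: invariant_rhok.
by move=> rho; exact: invariant_density_unique.
Qed.
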